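(* Let $\ell$ be an integer with $\ell>2$. There does not exist an integer $k$ such that $f_{2\ell}(n+k)=b_{2\ell}(n)$ for all integers $n\ge -k$. However, for each positive integer $j$, writing $T_j=\sum_{i=0}^{j-1}\ell\,(2\ell)^i=[\underbrace{\ell\;\cdots\;\ell}_{j}]_{2\ell}$ and $V_m=\sum_{i=0}^{m-1}(\ell-1)(2\ell)^i=[\underbrace{(\ell-1)\;\cdots\;(\ell-1)}_{m}]_{2\ell}$, we have $$f_{2\ell}(T_j+n)=b_{2\ell}(n)\quad\text{for all integers } n\in[-V_j,\,V_{j+1}],$$ and $f_{2\ell}(T_j+n)\neq b_{2\ell}(n)$ when $n=-V_j-1$ and when $n=V_{j+1}+1$.
   Context: For an integer $d\ge 2$ and an integer $n$, a hyper-$d$-ary representation of $n$ is an expression $n=\sum_{i\ge0}\epsilon_i d^i$ with finitely many nonzero $\epsilon_i$ and all $\epsilon_i\in\{0,1,\dots,d\}$; $f_d(n)$ denotes the number of such representations (so $f_d(n)=0$ for $n<0$). For even $d=2\ell$, a balanced $2\ell$-ary representation of $n$ is such an expression with all $\epsilon_i\in\{-\ell,-\ell+1,\dots,\ell-1,\ell\}$; $b_{2\ell}(n)$ denotes the number of such representations. Representations differing only by leading zeros are identified. Notation: $[\epsilon_k\;\cdots\;\epsilon_0]_{2\ell}=\sum_{i=0}^k\epsilon_i(2\ell)^i$. *)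

(* Defs.v *)
From mathcomp Require Import all_boot all_order all_algebra.
From mathcomp Require Import finmap zify.
From mathcomp Require Import mathcomp_extra boolp classical_sets functions cardinality.

Set Implicit Arguments.
Unset Strict Implicit.
Unset Printing Implicit Defensive.

Import Order.TTheory GRing.Theory Num.Theory.
Local Open Scope classical_set_scope.
Local Open Scope ring_scope.

(* A digit string (..., e_1, e_0) with finitely many nonzero entries, taken up
   to leading zeros, is encoded by the polynomial \sum_i e_i 'X^i, so that
   e_i = p`_i and \sum_i e_i d^i = p.[d]. *)
Definition representations (D : set int) (d n : int) : set {poly int} :=
  [set p : {poly int} | (forall i, D p`_i) /\ p.[d] = n].

Definition hyper_digits (d : nat) : set int := [set c | 0 <= c <= d%:Z].

Definition balanced_digits (l : nat) : set int := [set c | - l%:Z <= c <= l%:Z].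

(* [fset_set] sends an infinite set to the empty one, so these two counts are
   meaningful only for d >= 2 and l >= 2 respectively; see
   [finite_hyper_representations] and [finite_balanced_representations]. *)
Definition hyper_count (d : nat) (n : int) : nat :=
  #|` fset_set (representations (hyper_digits d) d%:Z n)|.

(* This is b_{2l}: the base is 2l. *)
Definition balanced_count (l : nat) (n : int) : nat :=
  #|` fset_set (representations (balanced_digits l) (2 * l)%N%:Z n)|.

(* [c c ... c]_d with m digits. *)
Definition repdigit (d : nat) (c : int) (m : nat) : int :=
  \sum_(0 <= i < m) c * d%:Z ^+ i.

Lemma representations_cons (D : set int) (d n c : int) (q : {poly int}) :
  representations D d n (q * 'X + c%:P) <->
  exists m, [/\ D c, representations D d m q & n = m * d + c].
Proof.
split=> [[Dp pn]|[m [Dc [Dq qm] ->]]].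
  exists q.[d]; split.
  - by have := Dp 0; rewrite coefD coefMX coefC /= add0r.
  - by split=> // i; have := Dp i.+1; rewrite coefD coefMX coefC /= addr0.
  - by rewrite -pn !hornerE.
split; last by rewrite !hornerE qm.
by case=> [|i]; rewrite coefD coefMX coefC /= ?add0r ?addr0.
Qed.

Lemma finite_int_itv (a b : int) : finite_set [set c : int | a <= c <= b].
Proof.
apply: (@sub_finite_set _ _ ((fun k : nat => a + k%:Z) @` `I_(absz (b - a)).+1)).
  by move=> c /= /andP[ac cb]; exists (absz (c - a)); lia.
by apply: finite_image; apply: finite_II.
Qed.

Lemma finite_bounded_polys (D : set int) (N : nat) : finite_set D ->
  finite_set [set p : {poly int} | (size p <= N)%N /\ forall i, D p`_i].
Proof.
move=> finD; elim: N => [|N IHN].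
  apply: (sub_finite_set _ (finite_set1 0)) => p /= [+ _].
  by rewrite leqn0 size_poly_eq0 => /eqP.
apply: (@sub_finite_set _ _
  ((fun x : {poly int} * int => x.1 * 'X + x.2%:P) @`
   ([set p : {poly int} | (size p <= N)%N /\ forall i, D p`_i] `*` D))).
  move=> p [].
  elim/poly_ind: p => [|q c _] sp Dp.
    exists (0, 0) => /=; last by rewrite mul0r add0r.
    by split; [split=> [|i]; [rewrite size_poly0|have := Dp i]|have := Dp 0];
       rewrite ?coef0.
  exists (q, c) => //=; split; last first.
    by have := Dp 0; rewrite coefD coefMX coefC /= add0r.
  split=> [|i]; last by have := Dp i.+1; rewrite coefD coefMX coefC /= addr0.
  by move: sp; rewrite size_MXaddC; case: ifP => [/andP[/eqP-> _]|_ //];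
     rewrite size_poly0.
by apply: finite_image; apply: finite_setX.
Qed.

Lemma finite_representations (D : set int) (d n : int) : finite_set D ->
  (forall c m q, D c -> representations D d m q ->
     (absz m < absz (m * d + c)%R)%N \/ (m = 0 /\ c = 0)) ->
  finite_set (representations D d n).
Proof.
move=> finD decr.
apply: (sub_finite_set _ (@finite_bounded_polys D (absz n) finD)) => p /= pn.
split; last by case: pn.
elim/poly_ind: p n pn => [|q c IHq] n; first by rewrite size_poly0.
move=> /representations_cons[m [Dc qm ->]].
have sq := IHq _ qm; rewrite size_MXaddC.
have [lt_m|[m0 ->]] := decr _ _ _ Dc qm.
  by case: ifP => // _; apply: leq_ltn_trans sq lt_m.
by move: sq; rewrite m0 leqn0 size_poly_eq0 => ->; rewrite eqxx.
Qed.

Lemma finite_hyper_representations (d : nat) (n : int) : (2 <= d)%N ->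
  finite_set (representations (hyper_digits d) d%:Z n).
Proof.
move=> d2; apply: finite_representations; first exact: finite_int_itv.
move=> c m q /= /andP[c0 cd] [Dq qm].
have m0 : 0 <= m.
  rewrite -qm horner_coef; apply: sumr_ge0 => i _.
  by rewrite mulr_ge0 ?exprn_ge0//; case/andP: (Dq i).
case: (eqVneq m 0) => [->|mN0].
  by case: (eqVneq c 0) => [->|cN0]; [right | left; lia].
have : m * 2 <= m * d%:Z by rewrite ler_wpM2l.
by left; lia.
Qed.

Lemma finite_balanced_representations (l : nat) (n : int) : (2 <= l)%N ->
  finite_set (representations (balanced_digits l) (2 * l)%N%:Z n).
Proof.
move=> l2; apply: finite_representations; first exact: finite_int_itv.
move=> c m q /= /andP[cl lc] _.
case: (eqVneq m 0) => [->|mN0].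
  by case: (eqVneq c 0) => [->|cN0]; [right | left; lia].
left; have [m_gt0|m_le0] := ltrP 0 m; nia.
Qed.

(* Main.v *)
Require Import Defs.
From mathcomp Require Import all_boot all_order all_algebra.
From mathcomp Require Import finmap zify.
From mathcomp Require Import classical_sets cardinality.

Set Implicit Arguments.
Unset Strict Implicit.
Unset Printing Implicit Defensive.

Import Order.TTheory GRing.Theory Num.Theory.
Local Open Scope ring_scope.

(** Write d = 2l. Sorting representations by their last digit gives, for all
    integers m,
      f(dm + r) = f(m) for 0 < r < d,   f(dm + d) = f(m + 1) + f(m),
      b(dm + r) = b(m) for |r| < l,     b(dm + l) = b(m) + b(m + 1).
    As T_(j+1) = d T_j + l, the shift by T_(j+1) aligns the two recursions, so
    the agreement interval [-V_j, V_(j+1)], and the disagreement just outside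
    it, propagate from j to j + 1; the induction starts at j = 0, where
    f = b = 1 on [0, l - 1] while f(-1) = 0, b(-1) = 1, f(l) = 1, b(l) = 2.
    If a shift k worked everywhere, then k = l mod d, since otherwise b(dm + l),
    which is at least 2, would equal f(m + h) for some h and all large m,
    whereas f takes the value 1 at arbitrarily large arguments. Then (k - l)/d
    is a shift that works too, and it has smaller absolute value. *)

(** * Counting representations by their last digit, for a general digit set *)

Lemma append_digit_inj (R : nzRingType) (c : R) :
  injective (fun q : {poly R} => q * 'X + c%:P).
Proof.
move=> p q /addIr eq_pq; apply/polyP=> i.
by have := congr1 (fun r : {poly R} => r`_i.+1) eq_pq; rewrite !coefMX.
Qed.

Lemma append_digitP (R : nzRingType) (p : {poly R}) :
  exists q c, p = q * 'X + c%:P.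
Proof.
elim/poly_ind: p => [|q c _]; last by exists q, c.
by exists 0, 0; rewrite mul0r add0r.
Qed.

Lemma card_append_digit (A : set {poly int}) (c : int) : finite_set A ->
  #|` fset_set [set q * 'X + c%:P | q in A]%classic| = #|` fset_set A|.
Proof.
by move=> finA; rewrite fset_set_image // card_imfset //=; apply: append_digit_inj.
Qed.

(** Since the last digit is forced to be [c], appending [c] is a bijection from the representations
    of [m]. *)
Lemma card_representations_one_digit (D : set int) (d m c : int) :
  finite_set (representations D d m) -> D c ->
  (forall m' c', D c' -> m * d + c = m' * d + c' -> m' = m /\ c' = c) ->
  #|` fset_set (representations D d (m * d + c))|
    = #|` fset_set (representations D d m)|.
Proof.
move=> fin_m Dc uniq_c; rewrite -(card_append_digit c fin_m).
congr #|` fset_set _|; apply/seteqP; split=> p /=.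
  have [q [c' ->]] := append_digitP p.
  move=> /representations_cons[m' [Dc' rm' /(uniq_c _ _ Dc')[em' ec']]].
  by exists q; rewrite -?em' -?ec'.
by case=> q rq <-; apply/representations_cons; exists m.
Qed.

Lemma card_representations_two_digits (D : set int) (d n m1 c1 m2 c2 : int) :
  finite_set (representations D d m1) -> finite_set (representations D d m2) ->
  D c1 -> D c2 -> c1 != c2 -> n = m1 * d + c1 -> n = m2 * d + c2 ->
  (forall m c, D c -> n = m * d + c ->
     (m = m1 /\ c = c1) \/ (m = m2 /\ c = c2)) ->
  #|` fset_set (representations D d n)|
    = (#|` fset_set (representations D d m1)|
       + #|` fset_set (representations D d m2)|)%N.
Proof.
move=> fin1 fin2 Dc1 Dc2 c12 en1 en2 only12.
rewrite -(card_append_digit c1 fin1) -(card_append_digit c2 fin2).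
set A := image _ _; set B := image (representations D d m2) _.
have finA : finite_set A by apply: finite_image.
have finB : finite_set B by apply: finite_image.
have -> : representations D d n = (A `|` B)%classic.
  apply/seteqP; split=> p /=.
    have [q [c ->]] := append_digitP p.
    move=> /representations_cons[m [Dc rm /(only12 _ _ Dc)[][em ec]]].
      by left; exists q; rewrite -?em -?ec.
    by right; exists q; rewrite -?em -?ec.
  by case=> -[q rq <-]; apply/representations_cons; [exists m1 | exists m2].
rewrite fset_setU // -cardfsUI -fset_setI //.
suff -> : (A `&` B)%classic = set0 by rewrite fset_set0 cardfs0 addn0.
(* A common element would have both [c1] and [c2] as its constant coefficient. *)
rewrite -subset0 => p [[q1 _ <-] [q2 _]] /(congr1 (fun p : {poly int} => p`_0)).
by rewrite !coefD !coefMX !coefC /= !add0r => /eqP; rewrite eq_sym (negPf c12).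
Qed.

Lemma card_representations0 (D : set int) (d : int) : D 0 ->
  (forall c m q, D c -> representations D d m q -> m * d + c = 0 ->
     m = 0 /\ c = 0) ->
  #|` fset_set (representations D d 0)| = 1%N.
Proof.
move=> D0 only0; suff -> : representations D d 0 = [set 0]%classic.
  by rewrite fset_set1 cardfs1.
apply/seteqP; split=> p /=; last by move=> ->; split=> [i|]; rewrite ?coef0 ?horner0.
elim/poly_ind: p => // q c IHq /representations_cons[m [Dc rm /esym e0]].
have [m0 c0] := only0 _ _ _ Dc rm e0.
by rewrite (IHq _) ?c0 ?mul0r ?add0r //; rewrite -m0.
Qed.

(** * Recursion and special values for hyper-d-ary counts *)

Lemma hyper_count_inner (d : nat) (m r : int) : (2 <= d)%N -> 0 < r < d%:Z ->
  hyper_count d (m * d%:Z + r) = hyper_count d m.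
Proof.
move=> d2 hr; apply: card_representations_one_digit.
- exact: finite_hyper_representations.
- by rewrite /hyper_digits /=; lia.
- move=> m' c' /andP[c'_ge c'_le] e; suff em : m' = m by split=> //; subst m'; lia.
  by have [||//] := ltrgtP m' m; nia.
Qed.

Lemma hyper_count_mul (d : nat) (m : int) : (2 <= d)%N ->
  hyper_count d (m * d%:Z) = (hyper_count d m + hyper_count d (m - 1))%N.
Proof.
move=> d2; apply: (@card_representations_two_digits _ _ _ _ 0 _ d%:Z);
  rewrite /hyper_digits /=; try exact: finite_hyper_representations; try lia.
move=> m' c' /andP[c'_ge c'_le] e.
have : m' = m \/ m' = m - 1 by nia.
by case=> em; subst m'; [left | right]; lia.
Qed.

Lemma hyper_count0 (d : nat) : (2 <= d)%N -> hyper_count d 0 = 1%N.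
Proof.
move=> d2; apply: card_representations0 => [|c m q /andP[c_ge c_le] [Dq qm] e].
  by rewrite /hyper_digits /=; lia.
(* Nonnegative digits give a nonnegative value; this excludes [m = -1], [c = d]. *)
have m0 : 0 <= m.
  rewrite -qm horner_coef; apply: sumr_ge0 => i _.
  by rewrite mulr_ge0 ?exprn_ge0//; case/andP: (Dq i).
by split; nia.
Qed.

Lemma hyper_countN1 (d : nat) : (2 <= d)%N -> hyper_count d (-1) = 0%N.
Proof.
(* At [m = 0] the recursion reads f(0) = f(0) + f(-1). *)
move=> d2; have := hyper_count_mul 0 d2.
by rewrite mul0r sub0r => /eqP; rewrite -{1}[hyper_count d 0]addn0 eqn_add2l => /eqP.
Qed.

Lemma hyper_count_eq1_unbounded (d N : nat) : (2 <= d)%N ->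
  exists2 M : int, N%:Z <= M & hyper_count d M = 1%N.
Proof.
move=> d2; elim: N => [|N [M NM fM]]; first by exists 0; rewrite ?hyper_count0.
(* Appending the digit 1 increases the number and keeps its count. *)
by exists (M * d%:Z + 1); [nia | rewrite hyper_count_inner //; lia].
Qed.

(** * Recursion and positivity for balanced counts *)

Lemma balanced_count_inner (l : nat) (m r : int) : (2 <= l)%N ->
  - l%:Z < r < l%:Z ->
  balanced_count l (m * (2 * l)%N%:Z + r) = balanced_count l m.
Proof.
move=> l2 hr; apply: card_representations_one_digit.
- exact: finite_balanced_representations.
- by rewrite /balanced_digits /=; lia.
- move=> m' c' /andP[c'_ge c'_le] e; suff em : m' = m by split=> //; subst m'; lia.
  by have [||//] := ltrgtP m' m; nia.
Qed.

Lemma balanced_count_half (l : nat) (m : int) : (2 <= l)%N ->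
  balanced_count l (m * (2 * l)%N%:Z + l%:Z)
    = (balanced_count l m + balanced_count l (m + 1))%N.
Proof.
move=> l2; apply: (@card_representations_two_digits _ _ _ _ l%:Z _ (- l%:Z));
  rewrite /balanced_digits /=; try exact: finite_balanced_representations; try lia.
move=> m' c' /andP[c'_ge c'_le] e.
have : m' = m \/ m' = m + 1 by nia.
by case=> em; subst m'; [left | right]; lia.
Qed.

Lemma balanced_count0 (l : nat) : (2 <= l)%N -> balanced_count l 0 = 1%N.
Proof.
move=> l2; apply: card_representations0 => [|c m q /andP[c_ge c_le] _ e].
  by rewrite /balanced_digits /=; lia.
have m0 : m = 0 by nia.
by split=> //; subst m; lia.
Qed.

(** Division by 2l with remainder in (-l, l]. Remainder l stands apart because it allows two last
    digits, l and -l. *)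
Variant centered_div_spec (l : nat) (n : int) : Prop :=
| CenteredInner m r of n = m * (2 * l)%N%:Z + r & - l%:Z < r < l%:Z
| CenteredHalf m of n = m * (2 * l)%N%:Z + l%:Z.

Lemma centered_divP (l : nat) (n : int) : (0 < l)%N ->
  centered_div_spec l n.
Proof.
move=> l0; have d0 : (2 * l)%N%:Z != 0 :> int by lia.
have en := divz_eq n (2 * l)%N%:Z.
have r0 := modz_ge0 n d0; have rd := ltz_mod n d0.
set m := (n %/ _)%Z in en; set r := (n %% _)%Z in en r0 rd.
have [rl|lr|rl] := ltrgtP r l%:Z.
- by apply: (@CenteredInner _ _ m r) => //; lia.
- by apply: (@CenteredInner _ _ (m + 1) (r - (2 * l)%N%:Z)); lia.
- by apply: (@CenteredHalf _ _ m); lia.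
Qed.

(** Descent on |n|: for nonzero n the centered quotient is smaller in absolute value. *)
Lemma balanced_count_gt0 (l : nat) (n : int) : (2 <= l)%N ->
  (0 < balanced_count l n)%N.
Proof.
move=> l2; have [k le_nk] := ubnP (absz n); elim: k => // k IHk in n le_nk *.
have [m r en hr|m en] := @centered_divP l n ltac:(lia).
  have [n0|nN0] := eqVneq n 0; first by rewrite n0 balanced_count0.
  by rewrite en balanced_count_inner // IHk //; case: (eqVneq m 0) => ?; nia.
by rewrite en balanced_count_half // addn_gt0 IHk //; case: (eqVneq m 0) => ?; nia.
Qed.

(** * The agreement interval and its two ends *)

Lemma repdigit0 (d : nat) (c : int) : repdigit d c 0 = 0.
Proof. by rewrite /repdigit big_geq. Qed.

Lemma repdigitS (d : nat) (c : int) (j : nat) :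
  repdigit d c j.+1 = repdigit d c j * d%:Z + c.
Proof.
rewrite /repdigit big_nat_recl // expr0 mulr1 addrC mulr_suml; congr (_ + _).
by apply: eq_bigr => i _; rewrite exprSr mulrA.
Qed.

Lemma repdigit_ge0 (d : nat) (c : int) (j : nat) : 0 <= c -> 0 <= repdigit d c j.
Proof. by move=> c0; apply: sumr_ge0 => i _; rewrite mulr_ge0 ?exprn_ge0. Qed.

Lemma hyper_count_small (d : nat) (n : int) : (2 <= d)%N -> 0 <= n < d%:Z ->
  hyper_count d n = 1%N.
Proof.
move=> d2 hn; have [->|n0] := eqVneq n 0; first exact: hyper_count0.
rewrite -[n]add0r -[0](mul0r d%:Z) hyper_count_inner //; last by lia.
exact: hyper_count0.
Qed.

Lemma balanced_count_small (l : nat) (n : int) : (2 <= l)%N ->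
  - l%:Z < n < l%:Z -> balanced_count l n = 1%N.
Proof.
move=> l2 hn; rewrite -[n]add0r -[0](mul0r (2 * l)%N%:Z).
by rewrite balanced_count_inner // balanced_count0.
Qed.

Lemma hyper_count_eq_balanced_count (l j : nat) (n : int) : (2 <= l)%N ->
  let V := repdigit (2 * l) (l%:Z - 1) in
  - V j <= n <= V j.+1 ->
  hyper_count (2 * l) (repdigit (2 * l) l%:Z j + n) = balanced_count l n.
Proof.
move=> l2 V; have d2 : (2 <= 2 * l)%N by lia.
set T := repdigit (2 * l) l%:Z.
have VS i : V i.+1 = V i * (2 * l)%N%:Z + (l%:Z - 1) := repdigitS _ _ _.
have TS i : T i.+1 = T i * (2 * l)%N%:Z + l%:Z := repdigitS _ _ _.
elim: j n => [|j IHj] n.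
  rewrite VS [V 0]repdigit0 [T 0]repdigit0 add0r => hn.
  by rewrite hyper_count_small ?balanced_count_small //; lia.
move=> hn; have VSj := VS j; have VSj1 := VS j.+1.
have [m r en hr|m en] := @centered_divP l n ltac:(lia).
  rewrite en balanced_count_inner // TS.
  rewrite (_ : _ + l%:Z + _ = (T j + m) * (2 * l)%N%:Z + (l%:Z + r)); last by lia.
  (* Here 0 < l + r < 2l, and V_(j+1) = 2l V_j + l - 1 keeps [m] within [-V_j, V_(j+1)]. *)
  by rewrite hyper_count_inner; [apply: IHj; nia | lia | lia].
rewrite en balanced_count_half // TS.
(* The two last digits l add up to the base, so a carry turns [m] into [m + 1]. Both [m] and [m + 1]
   lie in the interval for [j]. *)
rewrite (_ : _ + l%:Z + _ = (T j + (m + 1)) * (2 * l)%N%:Z); last by lia.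
rewrite hyper_count_mul // (_ : _ - 1 = T j + m); last by lia.
by rewrite !IHj; [rewrite addnC | nia | nia].
Qed.

(** As -V_(j+1) - 1 = 2l(-V_j - 1) + l, each count splits into a term at -V_j, where both agree, and
    a term at -V_j - 1, where they differ by induction. *)
Lemma hyper_count_neq_below (l j : nat) : (2 <= l)%N ->
  let n := - repdigit (2 * l) (l%:Z - 1) j - 1 in
  hyper_count (2 * l) (repdigit (2 * l) l%:Z j + n) <> balanced_count l n.
Proof.
move=> l2 /=; have d2 : (2 <= 2 * l)%N by lia.
elim: j => [|j IHj].
  by rewrite !repdigit0 oppr0 !add0r hyper_countN1 ?balanced_count_small //; lia.
have V0 i : 0 <= repdigit (2 * l) (l%:Z - 1) i by apply: repdigit_ge0; lia.
have V_j := V0 j; have V_j1 := V0 j.+1.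
rewrite !repdigitS; set V := repdigit _ (_ - _) j in IHj V_j *.
set T := repdigit _ _ j in IHj *.
rewrite (_ : - _ - 1 = (- V - 1) * (2 * l)%N%:Z + l%:Z); last by lia.
rewrite balanced_count_half //.
rewrite (_ : _ + (_ + l%:Z) = (T - V) * (2 * l)%N%:Z); last by lia.
rewrite hyper_count_mul // subrK hyper_count_eq_balanced_count //; last by rewrite -/V; lia.
by rewrite [RHS]addnC => /addnI; rewrite -addrA.
Qed.

(** As V_(j+2) + 1 = 2l V_(j+1) + l, the terms at V_(j+1) cancel and those at V_(j+1) + 1 differ by
    induction. *)
Lemma hyper_count_neq_above (l j : nat) : (2 <= l)%N ->
  let n := repdigit (2 * l) (l%:Z - 1) j.+1 + 1 in
  hyper_count (2 * l) (repdigit (2 * l) l%:Z j + n) <> balanced_count l n.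
Proof.
move=> l2 /=; have d2 : (2 <= 2 * l)%N by lia.
elim: j => [|j IHj].
  rewrite repdigitS !repdigit0 mul0r !add0r subrK hyper_count_small //; last by lia.
  rewrite -[l%:Z]add0r -[0](mul0r (2 * l)%N%:Z) balanced_count_half //.
  by rewrite !balanced_count_small //; lia.
have V0 i : 0 <= repdigit (2 * l) (l%:Z - 1) i by apply: repdigit_ge0; lia.
have V_j := V0 j; have V_j1 := V0 j.+1.
rewrite [repdigit _ _ j.+2]repdigitS [repdigit _ l%:Z _]repdigitS.
set V := repdigit _ _ j.+1 in IHj V_j1 *; set T := repdigit _ l%:Z j in IHj *.
rewrite (_ : _ + (l%:Z - 1) + 1 = V * (2 * l)%N%:Z + l%:Z); last by lia.
rewrite balanced_count_half //.
rewrite (_ : _ + (_ + l%:Z) = (T + (V + 1)) * (2 * l)%N%:Z); last by lia.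
rewrite hyper_count_mul // (_ : _ - 1 = T + V); last by lia.
rewrite [hyper_count _ (T + V)]hyper_count_eq_balanced_count //; last by rewrite -/V; lia.
by rewrite addnC => /addnI.
Qed.

(** * Impossibility of a global shift, by descent on |k| *)

Lemma no_global_shift (l : nat) (k : int) : (2 < l)%N ->
  ~ (forall n : int, - k <= n ->
       hyper_count (2 * l) (n + k) = balanced_count l n).
Proof.
move=> l3; have d2 : (2 <= 2 * l)%N by lia.
have l2 : (2 <= l)%N by lia.
have [K le_kK] := ubnP (absz k); elim: K => // K IHK in k le_kK *.
move=> shift; have d0 : (2 * l)%N%:Z != 0 :> int by lia.
have := divz_eq (k - l%:Z) (2 * l)%N%:Z.
have := modz_ge0 (k - l%:Z) d0; have := ltz_mod (k - l%:Z) d0.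
set h := (_ %/ _)%Z; set s := (_ %% _)%Z => sd s0 ek.
have [es|sN0] := eqVneq s 0.
  have lt_hk : (absz h < absz k)%N by case: (eqVneq h 0) => ?; nia.
  apply: (IHK h) => [|n hn]; first by lia.
  (* With d = 2l and k = dh + l: b(n) = b(dn) = f(dn + k) = f(d(n + h) + l) = f(n + h). *)
  rewrite -[RHS](@balanced_count_inner l n 0) //; last by lia.
  rewrite -shift; last by nia.
  rewrite (_ : _ + k = (n + h) * (2 * l)%N%:Z + l%:Z); last by lia.
  by rewrite hyper_count_inner //; lia.
(* The bound makes M - h - 1 at least |k|, so the argument chosen next is at least -k. *)
have [M hM fM] := hyper_count_eq1_unbounded (absz k + absz h + 1)%N d2.
have := shift ((M - h - 1) * (2 * l)%N%:Z + l%:Z).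
rewrite (_ : _ + k = M * (2 * l)%N%:Z + s); last by lia.
rewrite hyper_count_inner //; last by lia.
rewrite balanced_count_half // fM => /(_ _)-e.
have := balanced_count_gt0 (M - h - 1) l2.
have := balanced_count_gt0 (M - h - 1 + 1) l2.
have {}e := e ltac:(nia); lia.
Qed.

Theorem theorem6p1 (l : nat) (hl : (2 < l)%N) :
  (~ exists k : int, forall n : int, - k <= n ->
       hyper_count (2 * l) (n + k) = balanced_count l n)
  /\
  (forall j : nat, (0 < j)%N ->
     let T := repdigit (2 * l) l%:Z in
     let V := repdigit (2 * l) (l%:Z - 1) in
     [/\ forall n : int, - V j <= n <= V j.+1 ->
           hyper_count (2 * l) (T j + n) = balanced_count l n,
         hyper_count (2 * l) (T j + (- V j - 1)) <> balanced_count l (- V j - 1)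
       & hyper_count (2 * l) (T j + (V j.+1 + 1)) <> balanced_count l (V j.+1 + 1)]).
Proof.
have l2 : (2 <= l)%N by lia.
split=> [[k]|j _ T V]; first exact: no_global_shift.
split=> [n|  |]; first exact: hyper_count_eq_balanced_count.
  exact: hyper_count_neq_below.
exact: hyper_count_neq_above.
Qed.
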